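(* Let $n\ge 2$. A loopless quantum graph on $M_n$ with adjacency operator $G$ is acted on by the unitary group $U(n)$ if and only if $G$ is the adjacency operator of the edgeless quantum graph $K_n^c$ or of the complete quantum graph $K_n$. That is, the loopless quantum graphs on $M_n$ acted on by $U(n)$ are precisely $K_n^c$ and $K_n$.
   Context: $M_n=M_n(\mathbb C)$, with matrix units $E_{ij}$. A quantum graph on $M_n$ is a linear map $G\colon M_n\to M_n$ (its adjacency operator) satisfying $\sum_{k} G(E_{ik})G(E_{kj})=G(E_{ij})$ for all $i,j$ (Schur idempotency, in the unnormalised convention) and $G(x^\dagger)=G(x)^\dagger$ for all $x$ (realness). It is loopless if $\sum_k G(E_{ik})E_{kj}=0$ for all $i,j$. A group $X\subseteq U(n)$ acts on $G$ if $G(uxu^\dagger)=u\,G(x)\,u^\dagger$ for all $u\in X$, $x\in M_n$. The edgeless quantum graph $K_n^c$ has adjacency operator $0$; the complete quantum graph $K_n$ has adjacency operator $x\mapsto \mathrm{Tr}(x)I-\tfrac1n x$. *)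

(* Defs.v *)
From HB Require Import structures.
From mathcomp Require Import all_boot all_order all_algebra.
From mathcomp Require Export spectral sesquilinear.
From mathcomp Require Export reals.
From mathcomp Require Export complex.

Set Implicit Arguments.
Unset Strict Implicit.
Unset Printing Implicit Defensive.

Import Order.TTheory GRing.Theory Num.Theory.
Local Open Scope ring_scope.
Local Open Scope sesquilinear_scope.

(* The matrix units E_ij are [delta_mx i j] and the adjoint of a matrix M is
   its conjugate transpose [M^t*]. *)

Record quantum_graph (C : numClosedFieldType) (n : nat)
    (G : {linear 'M[C]_n -> 'M[C]_n}) : Prop := QuantumGraph {
  schur_idempotent : forall i j : 'I_n,
    \sum_(k < n) (G (delta_mx i k) *m G (delta_mx k j)) = G (delta_mx i j);
  adjacency_real : forall x : 'M[C]_n, G (x^t*) = (G x)^t*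
}.

Definition loopless (C : numClosedFieldType) (n : nat)
    (G : {linear 'M[C]_n -> 'M[C]_n}) : Prop :=
  forall i j : 'I_n, \sum_(k < n) (G (delta_mx i k) *m delta_mx k j) = 0.

Definition unitary_group (C : numClosedFieldType) (n : nat) : {pred 'M[C]_n} :=
  [pred u | u \is unitarymx].

(* Only meant for X a subgroup of [unitary_group C n]. *)
Definition acted_on_by (C : numClosedFieldType) (n : nat)
    (X : {pred 'M[C]_n}) (G : {linear 'M[C]_n -> 'M[C]_n}) : Prop :=
  forall u x : 'M[C]_n, u \in X -> G (u *m x *m u^t*) = u *m G x *m u^t*.

Definition edgeless_adj (C : numClosedFieldType) (n : nat) (x : 'M[C]_n) :
  'M[C]_n := 0.

Definition complete_adj (C : numClosedFieldType) (n : nat) (x : 'M[C]_n) :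
  'M[C]_n := (\tr x)%:M - n%:R^-1 *: x.

Fact edgeless_adj_linear (C : numClosedFieldType) (n : nat) :
  linear (@edgeless_adj C n).
Proof. by move=> a x y; rewrite /edgeless_adj scaler0 addr0. Qed.

HB.instance Definition _ (C : numClosedFieldType) (n : nat) :=
  GRing.isLinear.Build C 'M[C]_n 'M[C]_n *:%R (@edgeless_adj C n)
    (@edgeless_adj_linear C n).

Fact complete_adj_linear (C : numClosedFieldType) (n : nat) :
  linear (@complete_adj C n).
Proof.
move=> a x y; rewrite /complete_adj mxtraceD mxtraceZ raddfD /= -scale_scalar_mx.
by rewrite scalerDr scalerBr opprD !scalerA (mulrC a n%:R^-1) addrACA.
Qed.

HB.instance Definition _ (C : numClosedFieldType) (n : nat) :=
  GRing.isLinear.Build C 'M[C]_n 'M[C]_n *:%R (@complete_adj C n)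
    (@complete_adj_linear C n).

(* Main.v *)
(** A map covariant under [U(n)] commutes with [ad P] for every orthogonal
    projection [P], because [1 + ('i - 1) P] is unitary; by polarization it
    then commutes with [ad y] for every matrix [y].  Evaluating this on matrix
    units forces the form [x |-> a Tr(x) I + b x].  Looplessness gives
    [a = - n b] and Schur idempotency gives [a ^ 2 = a], so [(a, b)] is [(0, 0)]
    or [(1, - 1 / n)]. *)

Require Import Defs.
From HB Require Import structures.
From mathcomp Require Import all_boot all_order all_algebra.
From mathcomp Require Import spectral sesquilinear reals complex.
From mathcomp Require Import ring.

Set Implicit Arguments.
Unset Strict Implicit.
Unset Printing Implicit Defensive.

Import Order.TTheory GRing.Theory Num.Theory.
Local Open Scope ring_scope.

Section UnitaryCovariance.
Local Open Scope sesquilinear_scope.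
Variable C : numClosedFieldType.

(** * Commutators and matrix units *)

Definition lie_mx n (x y : 'M[C]_n) : 'M[C]_n := x *m y - y *m x.
Arguments lie_mx : simpl never.

Lemma lie_mxC n (x y : 'M[C]_n) : lie_mx x y = - lie_mx y x.
Proof. by rewrite /lie_mx opprB. Qed.

Lemma lie_mxE n (x y : 'M[C]_n) p q :
  lie_mx x y p q = (x *m y) p q - (y *m x) p q.
Proof. by rewrite !mxE. Qed.

Lemma lie_mxDl n (x x' y : 'M[C]_n) :
  lie_mx (x + x') y = lie_mx x y + lie_mx x' y.
Proof. by rewrite /lie_mx mulmxDl mulmxDr opprD addrACA. Qed.

Lemma lie_mxZl n a (x y : 'M[C]_n) : lie_mx (a *: x) y = a *: lie_mx x y.
Proof. by rewrite /lie_mx -scalemxAl -scalemxAr scalerBr. Qed.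

Lemma lie_mx_delta n (i j k l : 'I_n) :
  lie_mx (delta_mx i j) (delta_mx k l) =
  delta_mx i l *+ (j == k) - delta_mx k j *+ (l == i) :> 'M[C]_n.
Proof. by rewrite /lie_mx !mul_delta_mx_cond. Qed.

Lemma lie_mxZr n a (x y : 'M[C]_n) : lie_mx x (a *: y) = a *: lie_mx x y.
Proof. by rewrite lie_mxC lie_mxZl -scalerN -lie_mxC. Qed.

Lemma mulmx_delta_entry m n r (x : 'M[C]_(m, n)) i (j q : 'I_r) p :
  (x *m delta_mx i j) p q = x p i *+ (q == j).
Proof.
rewrite mxE (bigD1 i) //= big1 ?addr0 => [|k /negbTE nk].
  by rewrite mxE eqxx mulr_natr.
by rewrite mxE nk mulr0.
Qed.

Lemma delta_mulmx_entry m n r (x : 'M[C]_(m, n)) (i p : 'I_r) j q :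
  (delta_mx i j *m x) p q = x j q *+ (p == i).
Proof.
rewrite mxE (bigD1 j) //= big1 ?addr0 => [|k /negbTE nk].
  by rewrite mxE eqxx andbT mulr_natl.
by rewrite mxE nk andbF mul0r.
Qed.

(** Matrix units are common eigenvectors of all the ad E_kk; the eigenvalues are the weights of the
    diagonal torus. *)
Lemma lie_mx_diag_entry n (k : 'I_n) (x : 'M[C]_n) p q :
  lie_mx (delta_mx k k) x p q = ((k == p)%:R - (k == q)%:R) * x p q.
Proof.
rewrite lie_mxE delta_mulmx_entry mulmx_delta_entry mulrBl.
rewrite !mulr_natl !(eq_sym k).
by have [->|_] := eqVneq p k; have [->|_] := eqVneq q k; rewrite ?mulr0n.
Qed.

Lemma lie_mx_diag_delta n (k i j : 'I_n) :
  lie_mx (delta_mx k k) (delta_mx i j) =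
  ((k == i)%:R - (k == j)%:R) *: delta_mx i j :> 'M[C]_n.
Proof.
apply/matrixP=> p q; rewrite lie_mx_diag_entry !mxE.
by have [->|_] := eqVneq p i; have [->|_] := eqVneq q j; rewrite ?mulr0.
Qed.

(** * From unitary covariance to covariance under commutators *)

Lemma rank1_update_mul n (P x : 'M[C]_n) (w z : C) :
  (1%:M + w *: P) *m x *m (1%:M + z *: P) =
  x + w *: (P *m x) + z *: (x *m P) + (w * z) *: (P *m x *m P).
Proof.
rewrite mulmxDl mul1mx mulmxDr mulmx1 mulmxDl -!scalemxAl -!scalemxAr.
by rewrite scalerA addrA.
Qed.

Lemma update_trmxC n (P : 'M[C]_n) w :
  P^t* = P -> (1%:M + w *: P)^t* = 1%:M + w^* *: P.
Proof.
move=> PH; apply/matrixP=> i j.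
by rewrite -[in RHS]PH !mxE rmorphD rmorphM rmorph_nat eq_sym.
Qed.

(* [1 + ('i - 1) P] is the unitary that multiplies the range of [P] by ['i] and
   fixes its kernel. *)
Lemma projection_phase_unitary n (P : 'M[C]_n) :
  P^t* = P -> P *m P = P -> 1%:M + ('i - 1) *: P \is unitarymx.
Proof.
move=> PH PP; apply/unitarymxP; rewrite update_trmxC //.
rewrite -[X in X *m _]mulmx1 rank1_update_mul mulmx1 mul1mx PP -!addrA.
rewrite -!scalerDl rmorphB /= conjCi rmorph1.
(* With w = 'i - 1, the coefficient w + w^* + w w^* of [P] is |1 + w|^2 - 1 = 0. *)
rewrite (_ : _ + (_ + _) = 0) ?scale0r ?addr0 //.
by transitivity (- 1 - 'i ^+ 2 : C); [ring | rewrite sqrCi subrr].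
Qed.

(* With [u] the phase unitary above, [u x u^* - u^* x u = 2 'i [P, x]]: the
   terms in [P x P] cancel. *)
Lemma unitary_covariant_projection n (G : {linear 'M[C]_n -> 'M[C]_n}) P x :
  acted_on_by (@unitary_group C n) G -> P^t* = P -> P *m P = P ->
  G (lie_mx P x) = lie_mx P (G x).
Proof.
move=> GU PH PP; pose w : C := 'i - 1; pose u := 1%:M + w *: P.
have uU : u \is unitarymx by exact: projection_phase_unitary.
have conj_diff y : u *m y *m u^t* - u^t* *m y *m u = (2 * 'i) *: lie_mx P y.
  rewrite update_trmxC // !rank1_update_mul [w^* * w]mulrC opprD addrACA subrr.
  rewrite addr0 opprD addrACA opprD [X in X + _]addrACA subrr add0r -!scalerBl.
  rewrite -[w^* - w]opprB scaleNr -scalerBr rmorphB rmorph1 /= conjCi.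
  by congr (_ *: _); rewrite /w; ring.
apply: (scalerI (_ : 2 * 'i != 0 :> C)).
  by rewrite mulf_neq0 ?pnatr_eq0 ?neq0Ci.
rewrite -conj_diff -linearZ -conj_diff linearB /= (GU u) //.
by have := GU (u^t*) x; rewrite trmxCK => ->; rewrite // inE trmxC_unitary.
Qed.

(** For nonzero [v], dividing v^* v by the real number <v, v> gives an orthogonal projection;
    linearity restores the scalar. *)
Lemma unitary_covariant_rank1 n (G : {linear 'M[C]_n -> 'M[C]_n})
    (v : 'rV[C]_n) x :
  acted_on_by (@unitary_group C n) G ->
  G (lie_mx (v^t* *m v) x) = lie_mx (v^t* *m v) (G x).
Proof.
move=> GU; have [->|v0] := eqVneq v 0.
  by rewrite mulmx0 /lie_mx !mul0mx !mulmx0 subrr linear0.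
pose q := dotmx v v; have q0 : q != 0 by rewrite dnorm_eq0.
have vv : v *m v^t* = q%:M by rewrite [LHS]mx11_scalar -dotmxE.
pose P := q^-1 *: (v^t* *m v).
have QP : v^t* *m v = q *: P by rewrite scalerA divff // scale1r.
have qR : q^* = q by apply/CrealP/ger0_real/dnorm_ge0.
have QH : (v^t* *m v)^t* = v^t* *m v by rewrite trmx_mul map_mxM trmxCK.
have PH : P^t* = P.
  rewrite /P linearZ /= map_mxZ QH; congr (_ *: _).
  by rewrite fmorphV /= qR.
have PP : P *m P = P.
  rewrite -scalemxAl -scalemxAr mulmxA -[v^t* *m v *m _]mulmxA vv mul_mx_scalar.
  by rewrite -scalemxAl scalerA mulVf // scale1r.
by rewrite QP !(lie_mxZl q) linearZ /= unitary_covariant_projection.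
Qed.

(** Polarization: the defect [f] is linear and kills every v^* v. Expanding at v + w gives f(v^* w)
    + f(w^* v) = 0; replacing w by 'i w turns the sum into a difference, so both terms vanish.
    Matrix units have the form v^* w. *)
Lemma unitary_covariant_lie n (G : {linear 'M[C]_n -> 'M[C]_n}) x y :
  acted_on_by (@unitary_group C n) G -> G (lie_mx x y) = lie_mx x (G y).
Proof.
move=> GU; pose f z := G (lie_mx z y) - lie_mx z (G y).
have fD a b : f (a + b) = f a + f b.
  by rewrite /f !lie_mxDl linearD opprD addrACA.
have fZ c a : f (c *: a) = c *: f a.
  by rewrite /f !lie_mxZl linearZ /= [RHS]scalerBr.
have f_rank1 (v : 'rV[C]_n) : f (v^t* *m v) = 0.
  by rewrite /f unitary_covariant_rank1 // subrr.
pose cross (v w : 'rV[C]_n) : 'M[C]_n := v^t* *m w.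
have f_polar v w : f (cross v w) + f (cross w v) = 0.
  have := f_rank1 (v + w); rewrite [(_ + _)^T]linearD /= map_mxD.
  by rewrite mulmxDl !mulmxDr !fD !f_rank1 add0r addr0.
have f_cross v w : f (cross v w) = 0.
  have := f_polar v ('i *: w); rewrite /cross [(_ *: _)^T]linearZ /= map_mxZ.
  rewrite /= conjCi -scalemxAl -scalemxAr !fZ scaleNr -scalerBr => /eqP.
  rewrite scaler_eq0 (negbTE (neq0Ci C)) /= subr_eq0 => /eqP fE.
  have /eqP := f_polar v w; rewrite -fE -mulr2n -scaler_nat scaler_eq0.
  by rewrite pnatr_eq0 => /eqP.
apply/eqP; rewrite -subr_eq0 -/(f x); apply/eqP.
rewrite (matrix_sum_delta x).
have f_sum I (s : seq I) F : f (\sum_(i <- s) F i) = \sum_(i <- s) f (F i).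
  apply: (big_morph f fD).
  by have := fZ 0 0; rewrite !scale0r.
rewrite f_sum big1 // => i _; rewrite f_sum big1 // => j _; rewrite fZ.
have -> : delta_mx i j = cross (delta_mx 0 i) (delta_mx 0 j).
  by rewrite /cross trmx_delta map_delta_mx mul_delta_mx.
by rewrite f_cross scaler0.
Qed.

(** * Linear maps commuting with every ad x *)

Section LieCovariant.
Variables (n : nat) (G : {linear 'M[C]_n -> 'M[C]_n}).
Hypothesis GL : forall x y, G (lie_mx x y) = lie_mx x (G y).

(** Antisymmetry of the commutator; together with [GL] it gives [G x, y] = [x, G y]. *)
Lemma lie_covariantl x y : G (lie_mx x y) = lie_mx (G x) y.
Proof. by rewrite lie_mxC linearN /= GL [RHS]lie_mxC. Qed.

(** [G] commutes with every ad E_kk, so it preserves weights: the (p, q) entry of G(E_ij) vanishes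
    unless E_pq and E_ij have the same weights. *)
Lemma lie_covariant_weight (i j p q k : 'I_n) :
  ((k == i)%:R - (k == j)%:R) * G (delta_mx i j) p q =
  ((k == p)%:R - (k == q)%:R) * G (delta_mx i j) p q.
Proof. by rewrite -lie_mx_diag_entry -GL lie_mx_diag_delta linearZ mxE. Qed.

Lemma lie_covariant_offdiag (i j : 'I_n) : i != j ->
  G (delta_mx i j) = G (delta_mx i j) i j *: delta_mx i j.
Proof.
move=> ij; apply/matrixP=> p q; rewrite [RHS]mxE mxE.
have := lie_covariant_weight i j p q.
have [->|pi] := eqVneq p i; last first.
  (* The weight identity at k = i reads g = - g *+ (i == q) for the entry g, and g = 0 follows in
     characteristic zero. *)
  move=> /(_ i); rewrite eqxx (negbTE ij) eq_sym (negbTE pi) subr0 mul1r sub0r.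
  rewrite mulNr mulr_natl andFb mulr0 => /eqP; rewrite -addr_eq0 -mulrS.
  by rewrite mulrn_eq0 => /eqP.
(* At k = j the weight of E_ij is -1, while that of E_iq is 0 for q other than j. *)
have [->|qj] := eqVneq q j => /(_ j); first by rewrite mulr1.
rewrite eqxx [j == i]eq_sym (negbTE ij) [j == q]eq_sym (negbTE qj) subrr sub0r.
by rewrite mulN1r mul0r mulr0 => /eqP; rewrite oppr_eq0 => /eqP.
Qed.

Lemma lie_covariant_diag_entry (i p q : 'I_n) :
  p != q -> G (delta_mx i i) p q = 0.
Proof.
move=> pq; have := lie_covariant_weight i i p q p.
by rewrite subrr eqxx (negbTE pq) subr0 mul0r mul1r.
Qed.

(** Apply [G] to [E_ij, E_ji] through either factor and compare the (i, i) entries. *)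
Lemma lie_covariant_coef_sym (i j : 'I_n) : i != j ->
  G (delta_mx i j) i j = G (delta_mx j i) j i.
Proof.
move=> ij; have ji : j != i by rewrite eq_sym.
have := lie_covariantl (delta_mx i j) (delta_mx j i); rewrite GL.
rewrite (lie_covariant_offdiag ij) (lie_covariant_offdiag ji) lie_mxZr lie_mxZl.
rewrite lie_mx_delta !eqxx => /matrixP /(_ i i).
by rewrite !mxE !eqxx (negbTE ij) /= subr0 !mulr1 => ->.
Qed.

(** For distinct j and k, [E_ij, E_jk] = E_ik carries the coefficient at E_ij over to E_ik. *)
Lemma lie_covariant_coef_row (i j k : 'I_n) : i != j -> i != k ->
  G (delta_mx i j) i j = G (delta_mx i k) i k.
Proof.
move=> ij ik; have [->//|jk] := eqVneq j k.
have := lie_covariantl (delta_mx i j) (delta_mx j k).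
rewrite (lie_covariant_offdiag ij) lie_mxZl lie_mx_delta eqxx.
rewrite eq_sym (negbTE ik) subr0 => /matrixP /(_ i k) ->.
by rewrite !mxE !eqxx mulr1.
Qed.

(** The chain is (i, j), (i, k), (k, i), (k, l). *)
Lemma lie_covariant_coef (i j k l : 'I_n) : i != j -> k != l ->
  G (delta_mx i j) i j = G (delta_mx k l) k l.
Proof.
move=> ij kl; have [ik|ik] := eqVneq i k.
  by move: kl; rewrite -ik; apply: lie_covariant_coef_row.
rewrite (lie_covariant_coef_row ij ik) lie_covariant_coef_sym //.
by apply: lie_covariant_coef_row; rewrite // eq_sym.
Qed.

End LieCovariant.

Lemma lie_covariant_form n (G : {linear 'M[C]_n.+2 -> 'M[C]_n.+2}) :
  (forall x y, G (lie_mx x y) = lie_mx x (G y)) ->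
  exists a b : C, forall x, G x = (a * \tr x)%:M + b *: x.
Proof.
(* Size at least 2 makes E_01 an off-diagonal unit from which [b] can be read. *)
move=> GL; pose b := G (delta_mx 0 1) 0 1.
have Gij i j : i != j -> G (delta_mx i j) = b *: delta_mx i j.
  move=> ij; rewrite (lie_covariant_offdiag GL ij).
  by rewrite (lie_covariant_coef GL ij (_ : 0 != 1)).
pose a i := G (delta_mx i i) i i - b.
(* Off position i the diagonal of G(E_ii) is constant: [G(E_ii), E_ij] = b E_ij says that its (i, i)
   and (j, j) entries differ by [b]. *)
have aE i j : a i = G (delta_mx i i) j j - b *+ (i == j).
  have [<-|ij] := eqVneq i j; first by [].
  have := lie_covariantl GL (delta_mx i i) (delta_mx i j).
  rewrite lie_mx_diag_delta eqxx (negbTE ij) subr0 scale1r (Gij _ _ ij).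
  move=> /matrixP /(_ i j); rewrite lie_mxE mulmx_delta_entry.
  rewrite delta_mulmx_entry !mxE !eqxx mulr1 /a => ->.
  by rewrite subr0 opprB addrC subrK.
have Gii i : G (delta_mx i i) = (a i)%:M + b *: delta_mx i i.
  apply/matrixP=> p q; rewrite !mxE; have [<-{q}|pq] := eqVneq p q.
    by rewrite (aE i p) andbb (eq_sym p) mulr_natr subrK.
  rewrite (lie_covariant_diag_entry GL) // add0r; have [pi|_] := eqVneq p i.
    by rewrite -pi eq_sym (negbTE pq) mulr0.
  by rewrite mulr0.
(* Applying [G] to E_ii - E_jj = [E_ij, E_ji] must give b (E_ii - E_jj), with no scalar part a_i -
   a_j. *)
have aC i j : a i = a j.
  have [->//|ij] := eqVneq i j; have ji : j != i by rewrite eq_sym.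
  have := GL (delta_mx i j) (delta_mx j i); rewrite (Gij _ _ ji) lie_mxZr.
  rewrite lie_mx_delta !eqxx linearB /= !Gii => /matrixP /(_ i i).
  rewrite !mxE !eqxx (negbTE ij) /= !mulr0 !mulr1 addr0 subr0 => /eqP.
  by rewrite mulr1 !mulr1n addrAC eq_sym -subr_eq subrr eq_sym subr_eq0 => /eqP.
have Gdelta i j : G (delta_mx i j) = (a 0 *+ (i == j))%:M + b *: delta_mx i j.
  have [<-|ij] := eqVneq i j; first by rewrite Gii (aC i 0).
  by rewrite Gij // mulr0n raddf0 add0r.
exists (a 0), b => x; rewrite {1}(matrix_sum_delta x) linear_sum /=.
rewrite [X in _ + _ *: X](matrix_sum_delta x) scaler_sumr /mxtrace.
rewrite mulr_sumr raddf_sum -big_split; apply: eq_bigr => i _ /=.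
rewrite linear_sum /=.
transitivity (\sum_j ((a 0 * x i j *+ (i == j))%:M +
                       b *: (x i j *: delta_mx i j))).
  apply: eq_bigr => j _; rewrite linearZ /= Gdelta scalerDr scale_scalar_mx.
  by rewrite mulrnAr (mulrC (x i j)) !scalerA (mulrC b).
rewrite big_split /= -scaler_sumr; congr (_ + _); rewrite (bigD1 i) //= eqxx.
by rewrite big1 ?addr0 // => j /negbTE; rewrite eq_sym => ->; rewrite raddf0.
Qed.

(** * Schur and loop sums of x |-> a Tr(x) I + b x *)

(** The two mixed products each give a b E_ij; the factor n comes from E_ik E_kj = E_ij for every k.
    General [a] and [b] serve both the classification and the complete graph. *)
Lemma schur_sum n (a b : C) (i j : 'I_n) :
  \sum_(k < n) (((a *+ (i == k))%:M + b *: delta_mx i k) *m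
                ((a *+ (k == j))%:M + b *: delta_mx k j)) =
  (a ^+ 2 *+ (i == j))%:M + (2 * a * b + n%:R * b ^+ 2) *: delta_mx i j.
Proof.
transitivity (\sum_(k < n) ((a ^+ 2 *+ (k == j) *+ (i == k))%:M +
    (b * a *+ (i == k)) *: delta_mx k j + (b * a *+ (k == j)) *: delta_mx i k +
    b ^+ 2 *: delta_mx i j)).
  apply: eq_bigr => k _; rewrite mulmxDl !mulmxDr mul_scalar_mx scale_scalar_mx.
  rewrite mul_scalar_mx mul_mx_scalar -scalemxAl -scalemxAr mul_delta_mx.
  by rewrite !scalerA !mulrnAl !mulrnAr -!expr2 (mulrC _ b) !addrA.
rewrite !big_split /= sumr_const card_ord -scaler_nat scalerA.
rewrite (bigD1 i) //= eqxx big1 ?addr0 => [|k /negbTE]; last first.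
  by rewrite eq_sym => ->; rewrite mulr0n raddf0.
rewrite (bigD1 i) //= eqxx big1 ?addr0 => [|k /negbTE]; last first.
  by rewrite eq_sym => ->; rewrite scale0r.
rewrite (bigD1 j) //= eqxx big1 ?addr0 => [|k /negbTE ->]; last first.
  by rewrite scale0r.
by rewrite -!addrA -!scalerDl !mulr1n; congr (_ + _ *: _); ring.
Qed.

Lemma loop_sum n (a b : C) (i j : 'I_n) :
  \sum_(k < n) (((a *+ (i == k))%:M + b *: delta_mx i k) *m delta_mx k j) =
  (a + n%:R * b) *: delta_mx i j.
Proof.
transitivity (\sum_(k < n) ((a *+ (i == k)) *: delta_mx k j +
                            b *: delta_mx i j : 'M[C]_n)).
  apply: eq_bigr => k _.
  by rewrite mulmxDl mul_scalar_mx -scalemxAl mul_delta_mx.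
rewrite big_split /= sumr_const card_ord -scaler_nat scalerA.
rewrite (bigD1 i) //= eqxx big1 ?addr0 => [|k /negbTE]; last first.
  by rewrite eq_sym => ->; rewrite scale0r.
by rewrite -scalerDl.
Qed.

Lemma mxtrace_delta n (i j : 'I_n) : \tr (delta_mx i j : 'M[C]_n) = (i == j)%:R.
Proof.
rewrite /mxtrace (bigD1 i) //= big1 ?addr0 => [|k /negbTE nk]; rewrite mxE.
  by rewrite eqxx.
by rewrite nk.
Qed.

(** Puts the complete graph in the shape of [schur_sum] and [loop_sum], with a = 1 and b = -1/n. *)
Lemma complete_adj_delta n (i j : 'I_n) :
  complete_adj (delta_mx i j) =
  (1 *+ (i == j))%:M + (- n%:R^-1) *: delta_mx i j :> 'M[C]_n.
Proof.
by rewrite /complete_adj scaleNr mxtrace_delta.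
Qed.

(** * The two graphs and the classification *)

Lemma edgeless_quantum_graph n :
  quantum_graph (@edgeless_adj C n) /\ loopless (@edgeless_adj C n).
Proof.
split; first split; rewrite /loopless /edgeless_adj => *.
- by rewrite big1 // => k _; rewrite mulmx0.
- by rewrite trmx0 map_mx0.
- by rewrite big1 // => k _; rewrite mul0mx.
Qed.

Lemma complete_quantum_graph n : (0 < n)%N ->
  quantum_graph (@complete_adj C n) /\ loopless (@complete_adj C n).
Proof.
move=> n_gt0; have n0 : n%:R != 0 :> C by rewrite pnatr_eq0 -lt0n.
split; first split.
- move=> i j /=; rewrite complete_adj_delta.
  under eq_bigr do rewrite !complete_adj_delta.
  (* Here 2 a b + n b^2 = -2/n + 1/n = b. *)
  by rewrite schur_sum expr1n; congr (_ + _ *: _); field.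
- move=> x; apply/matrixP=> i j /=; rewrite /complete_adj !mxE.
  rewrite rmorphB rmorphMn rmorphM fmorphV rmorph_nat eq_sym /mxtrace.
  by rewrite rmorph_sum; congr (_ *+ _ - _); apply: eq_bigr => k _; rewrite !mxE.
- move=> i j /=; under eq_bigr do rewrite complete_adj_delta.
  by rewrite loop_sum mulrN divff // subrr scale0r.
Qed.

Lemma complete_unitary_covariant n :
  acted_on_by (@unitary_group C n) (@complete_adj C n).
Proof.
move=> u x; rewrite inE => uU /=; rewrite /complete_adj mulmxBr mulmxBl.
rewrite mul_mx_scalar -!scalemxAl (unitarymxP uU) scalemx1.
rewrite -scalemxAr -scalemxAl mxtrace_mulC mulmxA.
by rewrite (mulmx1C (unitarymxP uU)) mul1mx.
Qed.

(* Looplessness reads [a = - n b] and the [(1, 1)] entry of Schur idempotency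
   at [E_00] reads [a ^ 2 = a]. *)
Lemma loopless_covariant_form n (G : {linear 'M[C]_n.+2 -> 'M[C]_n.+2}) a b :
  quantum_graph G -> loopless G ->
  (forall x, G x = (a * \tr x)%:M + b *: x) ->
  G =1 @edgeless_adj C n.+2 \/ G =1 @complete_adj C n.+2.
Proof.
move=> QG LG GE; have n0 : n.+2%:R != 0 :> C by rewrite pnatr_eq0.
have Gdelta i j : G (delta_mx i j) = (a *+ (i == j))%:M + b *: delta_mx i j.
  by rewrite GE mxtrace_delta mulr_natr.
have /matrixP/(_ 0 0) := LG 0 0.
under eq_bigr do rewrite Gdelta.
rewrite loop_sum !mxE !eqxx mulr1 => /eqP; rewrite addr_eq0 => /eqP aE.
have /matrixP/(_ 1 1) := schur_idempotent QG 0 0.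
under eq_bigr do rewrite !Gdelta.
rewrite Gdelta schur_sum !mxE !eqxx /= !mulr0 !addr0 !mulr1n => /eqP.
rewrite -subr_eq0 -{2}[a]mulr1 expr2 -mulrBr mulf_eq0 => /orP[/eqP a0|].
  left=> x; have /eqP : n.+2%:R * b = 0 by rewrite -[LHS]opprK -aE a0 oppr0.
  rewrite mulf_eq0 (negbTE n0) /= => /eqP b0.
  by rewrite GE a0 b0 mul0r raddf0 scale0r addr0.
rewrite subr_eq0 => /eqP a1; right=> x; rewrite GE a1 mul1r /complete_adj.
congr (_ + _); rewrite -scaleNr; congr (_ *: _).
apply: (mulfI n0); rewrite mulrN divff //.
by apply: oppr_inj; rewrite -aE a1 opprK.
Qed.

End UnitaryCovariance.

Theorem proposition3p5 (R : realType) (n : nat) (hn : (2 <= n)%N) :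
  (forall G : {linear 'M[R[i]]_n -> 'M[R[i]]_n},
     quantum_graph G -> loopless G ->
     (acted_on_by (@unitary_group R[i] n) G <->
      G =1 @edgeless_adj R[i] n \/ G =1 @complete_adj R[i] n)) /\
  (quantum_graph (@edgeless_adj R[i] n) /\ loopless (@edgeless_adj R[i] n)) /\
  (quantum_graph (@complete_adj R[i] n) /\ loopless (@complete_adj R[i] n)).
Proof.
split; last first.
  split; first exact: edgeless_quantum_graph.
  exact/complete_quantum_graph/ltnW.
(* [hn] leaves sizes n + 2, where the indices 0 and 1 exist and differ. *)
case: n hn => [|[|n]] // _ G QG LG; split=> [GU|[GE|GE] u x uU].
- have [|a [b GE]] := @lie_covariant_form _ _ G.
    by move=> x y; apply: unitary_covariant_lie.
  exact: loopless_covariant_form QG LG GE.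
- by rewrite !GE /edgeless_adj mulmx0 mul0mx.
- by rewrite !GE; apply: complete_unitary_covariant.
Qed.
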